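(* For $n\ge1$, letting $W_n(t,q):=\sum_{\pi\in\mathfrak{S}_n(321)}t^{\mathsf{wex}\,\pi}q^{\mathsf{inv}\,\pi}$, we have $$W_n(t,q)=t^n\sum_{\pi\in\mathfrak{S}_n(\tau)}(q/t)^{\mathsf{des}\,\pi}q^{\mathsf{stat}\,\pi}$$ for each of the following pairs $(\tau,\mathsf{stat})$: $(231,31\text{-}2)$, $(231,13\text{-}2)$, $(231,\mathsf{adi}^* )$, $(312,2\text{-}31)$, $(312,2\text{-}13)$, $(312,\mathsf{adi})$, $(213,31\text{-}2)$, $(213,13\text{-}2)$, $(132,2\text{-}31)$, $(132,2\text{-}13)$.
   Context: $\mathfrak{S}_n(\tau)$: permutations of $[n]$ avoiding classical pattern $\tau$. $\mathsf{wex}\,\pi=\#\{i:\pi(i)\ge i\}$, $\mathsf{inv}\,\pi=\#\{i<j:\pi(i)>\pi(j)\}$, $\mathsf{des}\,\pi=\#\{i\in[n-1]:\pi(i)>\pi(i+1)\}$. Vincular counts: $(31\text{-}2)\pi=\#\{(i,j):i+1<j\le n,\pi(i+1)<\pi(j)<\pi(i)\}$, $(2\text{-}31)\pi=\#\{(i,j):j<i<n,\pi(i+1)<\pi(j)<\pi(i)\}$, $(2\text{-}13)\pi=\#\{(i,j):j<i<n,\pi(i)<\pi(j)<\pi(i+1)\}$, $(13\text{-}2)\pi=\#\{(i,j):i+1<j\le n,\pi(i)<\pi(j)<\pi(i+1)\}$. Admissible inversions: set $\pi(n+1)=0$; an inversion pair $(\pi(i),\pi(j))$ ($i<j$, $\pi(i)>\pi(j)$)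 is admissible if $\pi(j)<\pi(j+1)$ or some $l$ with $i<l<j$ has $\pi(l)<\pi(j)$; $\mathsf{adi}\,\pi$ counts them. Star admissible: set $\pi(0)=n+1$; an inversion pair $(\pi(i),\pi(j))$, $i<j$, is star admissible if $\pi(i-1)<\pi(i)$ or some $l$ with $i<l<j$ has $\pi(l)>\pi(i)$; $\mathsf{adi}^*\,\pi$ counts them. *)

(* Defs.v *)
(* Permutations of [n] are {perm 'I_n}; position i (1-based)
   holds the value P s i (1-based), with sentinels P s 0 = n+1, P s (n+1) = 0. *)
From HB Require Import structures.
From mathcomp Require Import all_boot all_order all_fingroup all_algebra.
Set Implicit Arguments. Unset Strict Implicit. Unset Printing Implicit Defensive.
Import GRing.Theory.

Section Stats.
Variable n : nat.
Implicit Types s : {perm 'I_n}.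

Definition word s : seq nat := [seq (val (s i)).+1 | i <- enum 'I_n].

(* 1-based value at position i, with P 0 = n+1 and P (n+1) = 0 *)
Definition P s (i : nat) : nat := if i == 0 then n.+1 else nth 0 (word s) i.-1.

(* classical pattern containment for a pattern a b c of length 3
   (a b c a permutation of 1 2 3) *)
Definition contains3 (a b c : nat) s : bool :=
  [exists i : 'I_n, exists j : 'I_n, exists k : 'I_n,
    [&& (i < j)%N, (j < k)%N,
        (val (s i) < val (s j))%N == (a < b)%N,
        (val (s i) < val (s k))%N == (a < c)%N &
        (val (s j) < val (s k))%N == (b < c)%N]].
Definition avoids3 (a b c : nat) s : bool := ~~ contains3 a b c s.

Definition wex s : nat := \sum_(1 <= i < n.+1) (i <= P s i)%N.
Definition invn s : nat :=
  \sum_(1 <= i < n.+1) \sum_(1 <= j < n.+1) ((i < j) && (P s j < P s i))%N.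
Definition des s : nat := \sum_(1 <= i < n) (P s (i.+1) < P s i)%N.

Definition v31_2 s : nat :=
  \sum_(1 <= i < n.+1) \sum_(1 <= j < n.+1)
     ((i.+1 < j) && (P s i.+1 < P s j) && (P s j < P s i))%N.
Definition v2_31 s : nat :=
  \sum_(1 <= i < n) \sum_(1 <= j < n.+1)
     ((j < i) && (P s i.+1 < P s j) && (P s j < P s i))%N.
Definition v2_13 s : nat :=
  \sum_(1 <= i < n) \sum_(1 <= j < n.+1)
     ((j < i) && (P s i < P s j) && (P s j < P s i.+1))%N.
Definition v13_2 s : nat :=
  \sum_(1 <= i < n.+1) \sum_(1 <= j < n.+1)
     ((i.+1 < j) && (P s i < P s j) && (P s j < P s i.+1))%N.

(* admissible inversions (pi(n+1) = 0) *)
Definition adi s : nat :=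
  \sum_(1 <= i < n.+1) \sum_(1 <= j < n.+1)
     [&& (i < j)%N, (P s j < P s i)%N &
         ((P s j < P s j.+1)%N || [exists l : 'I_n.+1,
             [&& (i < l)%N, (l < j)%N & (P s l < P s j)%N]])].

(* star admissible inversions (pi(0) = n+1) *)
Definition adis s : nat :=
  \sum_(1 <= i < n.+1) \sum_(1 <= j < n.+1)
     [&& (i < j)%N, (P s j < P s i)%N &
         ((P s i.-1 < P s i)%N || [exists l : 'I_n.+1,
             [&& (i < l)%N, (l < j)%N & (P s i < P s l)%N]])].

End Stats.

Local Open Scope ring_scope.

Definition Wn (R : comUnitRingType) (n : nat) (t q : R) : R :=
  \sum_(s : {perm 'I_n} | avoids3 3 2 1 s) t ^+ wex s * q ^+ invn s.

Definition Wtau (R : comUnitRingType) (n : nat) (a b c : nat)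
    (stat : {perm 'I_n} -> nat) (t q : R) : R :=
  t ^+ n * \sum_(s : {perm 'I_n} | avoids3 a b c s)
             (q / t) ^+ des s * q ^+ stat s.

(* Main.v *)
(** All eleven polynomials satisfy
      f_0 = 1,  f_1 = t,  f_(n+2) = t f_(n+1) + sum_(k <= n) q^(k+1) f_k f_(n+1-k).

    For 321, append the last letter: with the label r = n - (largest inversion
    bottom), a permutation labelled r has children r+1 (weight t) and j = 1..r
    (weight q^j). The depth-n weight T_n(r) of the subtree at label r satisfies
      T_(n+1)(r+1) - T_(n+1)(r) = q^(r+1) sum_(k <= n) q^k T_k(r) T_(n-k)(1),
    which at r = 0 is the recurrence for T_n(0).

    For 231 and 213, split after the first letter k: the smaller letters A and
    the larger letters B form two blocks. Give each adjacent descent the weight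
    q times its 31-2 contribution and each ascent t times its 13-2 contribution.
    If D_n and U_n are the total weights of the avoiders of size n preceded by a
    letter above, respectively below, all others, then the weight of k A B and of
    k B A factors into a D part (from k A) and a U part (from k B), which gives
    convolution recurrences for D and U common to the two patterns.

    On 231-avoiders adi* equals 13-2, and the patterns 312 and 132 follow by
    reverse-complement. *)
Require Import Defs.
From HB Require Import structures.
From mathcomp Require Import all_boot all_order all_fingroup all_algebra.
From mathcomp Require Import zify ring.
Set Implicit Arguments. Unset Strict Implicit. Unset Printing Implicit Defensive.
Import GRing.Theory.

(** * The recurrence *)

Section Recurrence.
Local Open Scope ring_scope.

Section Convolution.
Variable R : comUnitRingType.
Implicit Types (f g h : nat -> R) (t q : R).

Definition conv f g n : R := \sum_(i < n.+1) f i * g (n - i)%N.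

(** Truncation to polynomials turns [conv] into a product, so its commutativity and associativity
    come from the polynomial ring. *)
Lemma conv_coef f g n m : (n <= m)%N ->
  conv f g n = (\poly_(i < m.+1) f i * \poly_(i < m.+1) g i)`_n.
Proof.
move=> lenm; rewrite coefM; apply: eq_bigr => i _.
by rewrite !coef_poly !ifT //; have := ltn_ord i; lia.
Qed.

Lemma convC f g n : conv f g n = conv g f n.
Proof. by rewrite !(conv_coef _ _ (leqnn n)) mulrC. Qed.

Lemma convA f g h n : conv f (conv g h) n = conv (conv f g) h n.
Proof.
pose p f := \poly_(i < n.+1) (f i : R).
transitivity ((p f * (p g * p h))`_n).
  rewrite coefM; apply: eq_bigr => i _.
  have lt_i := ltn_ord i; rewrite (@conv_coef _ _ _ n) ?coef_poly ?ifT //; lia.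
rewrite mulrA coefM; apply: eq_bigr => i _.
by rewrite (@conv_coef _ _ _ n) ?[(p h)`__]coef_poly ?ifT //; have := ltn_ord i; lia.
Qed.

Lemma eq_conv f1 f2 g n : f1 =1 f2 -> conv f1 g n = conv f2 g n.
Proof. by move=> E; apply: eq_bigr => i _; rewrite E. Qed.

Lemma convSl f g n : conv f g n.+1 = f 0%N * g n.+1 + conv (f \o succn) g n.
Proof. by rewrite /conv big_ord_recl subn0; congr (_ + _); apply: eq_bigr. Qed.

Lemma convZl c f g n : conv (fun i => c * f i) g n = c * conv f g n.
Proof. by rewrite /conv big_distrr; apply: eq_bigr => i _; rewrite /= mulrA. Qed.

(* The recurrence of Cheng, Elizalde, Kasraoui and Sagan for inversions of
   321-avoiding permutations. *)
Definition cek_rec t q f :=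
  [/\ f 0%N = 1, f 1%N = t & forall n,
      f n.+2 = t * f n.+1 + \sum_(k < n.+1) q ^+ k.+1 * f k * f (n.+1 - k)%N].

Lemma cek_rec_unique t q f g : cek_rec t q f -> cek_rec t q g -> f =1 g.
Proof.
case=> f0 f1 fS [g0 g1 gS] n; elim/ltn_ind: n => -[|[|n]] IH; first by rewrite f0.
  by rewrite f1.
rewrite fS gS IH //; congr (_ + _); apply: eq_bigr => k _.
by have lt_k := ltn_ord k; rewrite !IH //; lia.
Qed.

(** The system produced by 31-2 weights. With [V i = q ^+ i * U i], the shift of [D] is
    [q * conv V D]; by associativity [conv D U] reappears inside, and [t * conv D U] is the shift of
    [U]. *)
Lemma cek_rec_left t q (D U : nat -> R) : D 0%N = 1 -> U 0%N = 1 ->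
    (forall n, D n.+1 = q * \sum_(i < n.+1) q ^+ (n - i) * (D i * U (n - i)%N)) ->
    (forall n, U n.+1 = t * conv D U n) ->
  cek_rec t q U.
Proof.
move=> D0 U0 DS US; pose V i := q ^+ i * U i.
have DV n : (D \o succn) n = q * conv V D n.
  by rewrite convC /= DS; congr (_ * _); apply: eq_bigr => i _; rewrite /V; ring.
split=> // [|n]; first by rewrite US /conv big_ord1 D0 U0 !mulr1.
rewrite US convSl D0 mul1r mulrDr (eq_conv _ _ DV) convZl -convA; congr (_ + _).
rewrite mulrCA !big_distrr; apply: eq_bigr => k _ /=.
have -> : (n.+1 - k = (n - k).+1)%N by have := ltn_ord k; lia.
by rewrite US /V exprS; ring.
Qed.

(** The system produced by 13-2 weights. In [PS], the term [D n.+1] yields the summand [k = 0] of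
    the recurrence, the head [V 0 = 1] yields [t * f n.+1], and the other terms yield the summands
    [k > 0], since [q * conv D U] is the shift of [D]. *)
Lemma cek_rec_right t q (D U : nat -> R) : D 0%N = 1 -> U 0%N = 1 ->
    (forall n, D n.+1 = q * conv D U n) ->
    (forall n, U n.+1 = t * \sum_(i < n.+1) q ^+ i * (D i * U (n - i)%N)) ->
  cek_rec t q (fun n => if n is m.+1 then t * conv D U m else 1).
Proof.
move=> D0 U0 DS US; pose V i := q ^+ i * D i.
have UV n : (U \o succn) n = t * conv V U n.
  by rewrite /= US; congr (_ * _); apply: eq_bigr => i _; rewrite /V mulrA.
split=> // [|n]; first by rewrite /conv big_ord1 D0 U0 !mulr1.
have PS : conv D U n.+1 = D n.+1 + t * conv V (conv D U) n.
  rewrite convC convSl U0 mul1r (eq_conv _ _ UV) convZl -convA.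
  by congr (_ + _ * _); apply: eq_bigr => i _; rewrite convC.
rewrite PS DS /(conv V) !(big_ord_recl n) /= /V D0 !subn0.
transitivity (t * (t * conv D U n) + (q * 1 * (t * conv D U n) +
  \sum_(i < n) t * (t * (q ^+ i.+1 * D i.+1 * conv D U (n - i.+1)%N)))).
  by rewrite -!big_distrr /=; ring.
congr (_ + (_ + _)); apply: eq_bigr => i _ /=.
rewrite /bump /= add1n (_ : (n.+1 - i.+1 = (n - i.+1).+1)%N); last first.
  by have := ltn_ord i; lia.
by rewrite DS add0n !exprS; ring.
Qed.

End Convolution.

(** * The generating tree of 321-avoiders *)

Section LabelTree.
Variables (R : comUnitRingType) (t q : R).

(* Transfer operator of the generating tree of 321-avoiders: a node with label
   [r] has a child [r.+1] of weight [t] (a new maximum is appended) and, for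
   [1 <= j <= r], a child [j] of weight [q ^+ j] (a letter with [j] larger
   letters before it is appended). *)
Definition grow (g : nat -> R) (r : nat) : R :=
  t * g r.+1 + \sum_(1 <= j < r.+1) q ^+ j * g j.

Definition tree_sum n := iter n grow (fun=> 1).

Lemma tree_sum_diff n r :
  tree_sum n.+1 r.+1 - tree_sum n.+1 r =
  q ^+ r.+1 * \sum_(k < n.+1) q ^+ k * (tree_sum k r * tree_sum (n - k) 1).
Proof.
have step m s : tree_sum m.+1 s.+1 - tree_sum m.+1 s =
    t * (tree_sum m s.+2 - tree_sum m s.+1) + q ^+ s.+1 * tree_sum m s.+1.
  by rewrite /= /grow (big_nat_recr s.+1) //=; ring.
elim: n r => [|n IHn] r; first by rewrite step big_ord1 /=; ring.
rewrite step IHn.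
(* Telescoping from label 1 up to [r.+1]; the induction hypothesis gives each increment. *)
have -> : tree_sum n.+1 r.+1 = tree_sum n.+1 1 +
    \sum_(1 <= j < r.+1) q ^+ j.+1 *
       \sum_(k < n.+1) q ^+ k * (tree_sum k j * tree_sum (n - k) 1).
  transitivity (tree_sum n.+1 1 + \sum_(1 <= j < r.+1)
    (tree_sum n.+1 j.+1 - tree_sum n.+1 j)).
    by rewrite telescope_sumr //; ring.
  by congr (_ + _); apply: eq_bigr => j _; rewrite IHn.
(* The summand [k = 0] is [tree_sum n.+1 1]. In the others one [grow] is unfolded: its [t] part
   matches the induction hypothesis at [r.+1], its sum over [j] the telescoped increments. *)
rewrite [in RHS]big_ord_recl subn0 /=.
rewrite [X in _ = _ * (_ + X)](eq_bigr (fun k : 'I_n.+1 => q * t * (q ^+ k * (tree_sum k r.+1 *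
    tree_sum (n - k) 1)) + \sum_(1 <= j < r.+1) q ^+ j.+1 * (q ^+ k *
       (tree_sum k j * tree_sum (n - k) 1)))); last first.
  move=> k _. rewrite /bump /= add1n add0n subSS exprS /grow mulrDl mulrDr; congr (_ + _).
    by ring.
  by rewrite big_distrl big_distrr; apply: eq_bigr => j _ /=; rewrite exprS; ring.
rewrite [X in _ = _ * (_ + X)]big_split -[X in _ = _ * (_ + (X + _))]big_distrr.
rewrite [X in _ = _ * (_ + (_ + X))]exchange_big /=.
under [X in _ = _ * (_ + (_ + X))]eq_bigr do rewrite -big_distrr /=.
by rewrite !exprS; ring.
Qed.

Lemma cek_rec_tree : cek_rec t q (tree_sum^~ 0).
Proof.
(* Label 0 has the single child 1, which converts values at label 1 into values at label 0. *)
have S0 n : tree_sum n.+1 0 = t * tree_sum n 1.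
  by rewrite /= /grow big_nil addr0.
split=> [||n]; rewrite ?S0 ?mulr1 //.
have /eqP := tree_sum_diff n 0; rewrite subr_eq addrC => /eqP ->.
rewrite mulrDr -S0; congr (_ + _); rewrite mulrCA !big_distrr /=.
apply: eq_bigr => k _ /=.
have -> : (n.+1 - k = (n - k).+1)%N by have := ltn_ord k; lia.
by rewrite S0 !exprS expr0; ring.
Qed.

End LabelTree.

End Recurrence.

(** * Words and patterns *)

Section Triplewise.
Variable r : nat -> nat -> nat -> bool.
Implicit Types w u v : seq nat.

Fixpoint triplewise w : bool :=
  if w is x :: u then pairwise (r x) u && triplewise u else true.

Lemma triplewiseP w :
  reflect (forall i j k, i < j -> j < k -> k < size w ->
             r (nth 0 w i) (nth 0 w j) (nth 0 w k))
          (triplewise w).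
Proof.
elim: w => [|x w IHw] /=; first exact: (iffP idP).
apply: (iffP andP) => [[/(pairwiseP 0) rx /IHw rw]|rw].
  move=> [|i] [|j] [|k] //= ltij ltjk ltk; last exact: rw.
  by apply: rx => //; rewrite inE; lia.
split; last by apply/IHw => i j k ? ? ?; apply: (rw i.+1 j.+1 k.+1).
by apply/(pairwiseP 0) => j k; rewrite !inE => ? ? ?; apply: (rw 0 j.+1 k.+1).
Qed.

Lemma triplewise_catl u v : triplewise (u ++ v) -> triplewise u.
Proof.
elim: u => //= x u IHu /andP[]; rewrite pairwise_cat => /and3P[_ -> _].
exact: IHu.
Qed.

Lemma triplewise_catr u v : triplewise (u ++ v) -> triplewise v.
Proof. by elim: u => //= x u IHu /andP[_ /IHu]. Qed.

(** The middle letter is unrestricted in the cross condition, so it covers triples with two letters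
    in [u] as well as those with two in [v]. *)
Lemma triplewise_cat u v : {in u & v, forall x z y, r x y z} ->
  triplewise u -> triplewise v -> triplewise (u ++ v).
Proof.
move=> cross + tv; elim: u cross => //= x u IHu cross /andP[px tu].
rewrite IHu //; last by move=> y z yu zv; apply: cross; rewrite ?inE ?yu ?orbT.
rewrite pairwise_cat px andbT /=; apply/andP; split.
  by apply/allrelP => y z yu zv; apply: cross; rewrite ?inE ?eqxx.
elim: v {tv IHu} cross => //= y v IHv cross; rewrite IHv ?andbT.
  by apply/allP => z zv; apply: cross; rewrite ?inE ?eqxx ?zv ?orbT.
by move=> a b au bv; apply: cross; rewrite ?inE ?bv ?orbT.
Qed.

Lemma triplewise_rcons w z :
  triplewise (rcons w z) = triplewise w && pairwise (fun x y => r x y z) w.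
Proof.
elim: w => //= x w ->; rewrite pairwise_rcons.
by rewrite [all _ _ && _]andbC andbACA.
Qed.

End Triplewise.

Definition pat_free (a b c x y z : nat) : bool :=
  ~~ [&& (x < y) == (a < b), (x < z) == (a < c) & (y < z) == (b < c)].

Lemma nth_word n (s : {perm 'I_n}) (i : 'I_n) : nth 0 (word s) i = (s i).+1.
Proof. by rewrite (nth_map i) ?size_enum_ord // nth_ord_enum. Qed.

Lemma size_word n (s : {perm 'I_n}) : size (word s) = n.
Proof. by rewrite size_map size_enum_ord. Qed.

Lemma avoids3E n a b c (s : {perm 'I_n}) :
  avoids3 a b c s = triplewise (pat_free a b c) (word s).
Proof.
apply/idP/triplewiseP => [/negP av i j k ltij ltjk|av].
  rewrite size_word => ltkn; apply/negP => bad; apply: av.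
  have ltjn := ltn_trans ltjk ltkn; have ltin := ltn_trans ltij ltjn.
  apply/existsP; exists (Ordinal ltin); apply/existsP; exists (Ordinal ltjn).
  apply/existsP; exists (Ordinal ltkn); rewrite /= ltij ltjk /=.
  have := bad; rewrite (nth_word s (Ordinal ltin)) (nth_word s (Ordinal ltjn)).
  by rewrite (nth_word s (Ordinal ltkn)) !ltnS.
apply/negP => /existsP[i /existsP[j /existsP[k /and5P[ltij ltjk h1 h2 h3]]]].
have := av i j k ltij ltjk; rewrite size_word ltn_ord => /(_ isT)/negP; apply.
by rewrite !nth_word !ltnS h1 h2 h3.
Qed.

Lemma word_inj n : injective (@word n).
Proof.
move=> s1 s2 eq_w; apply/permP => i; apply/val_inj/succn_inj.
by rewrite -!nth_word eq_w.
Qed.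

Lemma word_perm n (s : {perm 'I_n}) : perm_eq (word s) (iota 1 n).
Proof.
have U : uniq (word s).
  rewrite map_inj_uniq ?enum_uniq // => i j /succn_inj/val_inj; exact: perm_inj.
have sub : {subset word s <= iota 1 n}.
  by move=> x /mapP[i _ ->]; rewrite mem_iota add1n !ltnS /= ltn_ord.
apply: uniq_perm; rewrite ?iota_uniq //.
by have [] := uniq_min_size U sub; rewrite // size_iota size_word.
Qed.

(** The words are distinct, lie in the list on the right, and both lists have length n!. *)
Lemma words_perm n :
  perm_eq [seq word s | s : {perm 'I_n}] (permutations (iota 1 n)).
Proof.
have U : uniq [seq word s | s : {perm 'I_n}].
  by rewrite map_inj_uniq ?enum_uniq //; apply: word_inj.
apply: uniq_perm; rewrite ?permutations_uniq //.
have sub : {subset [seq word s | s : {perm 'I_n}] <= permutations (iota 1 n)}.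
  by move=> w /mapP[s _ ->]; rewrite mem_permutations word_perm.
have [] // := uniq_min_size U sub.
by rewrite size_permutations ?iota_uniq // size_iota size_map -cardE card_Sn.
Qed.

Lemma big_words (R : nmodType) n (p : pred (seq nat)) (f : seq nat -> R) :
  (\sum_(s : {perm 'I_n} | p (word s)) f (word s) =
   \sum_(w <- permutations (iota 1 n) | p w) f w)%R.
Proof.
by rewrite -(perm_big _ (words_perm n)) /= big_map big_enum_cond; apply: eq_bigl.
Qed.

(** * Decomposition at the first letter *)

Lemma pairwise_in (r : rel nat) s : {in s &, forall y z, r y z} -> pairwise r s.
Proof.
elim: s => //= x s IHs rs; apply/andP; split.
  by apply/allP => y ys; apply: rs; rewrite inE ?eqxx ?ys ?orbT.
by apply: IHs => y z ys zs; apply: rs; rewrite inE ?ys ?zs orbT.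
Qed.

(* [b = true] is the pattern 231 and [b = false] the pattern 213. Avoidance at
   the first letter [k] means that the letters below [k] all precede,
   respectively all follow, those above [k]. *)
Section FirstLetter.
Variable b : bool.

Definition split_free := pat_free 2 (if b then 3 else 1) (if b then 1 else 3).
Definition glue (A B : seq nat) := if b then A ++ B else B ++ A.

Lemma split_freeE k y z : k != y -> k != z ->
  split_free k y z = ~~ (if b then (k < y) && (z < k) else (y < k) && (k < z)).
Proof.
rewrite /split_free /pat_free; case: b => /= ky kz; congr (~~ _);
  case: (ltngtP k y) ky => //; case: (ltngtP k z) kz => //; lia.
Qed.

Lemma split_free_glue k s : k \notin s -> pairwise (split_free k) s ->
  s = glue [seq x <- s | x < k] [seq x <- s | k < x].
Proof.
rewrite /glue; elim: s => [|y s IHs]; first by case: b.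
rewrite inE negb_or => /andP[ky ks] /= /andP[/allP sky /(IHs ks) eqs].
have free z : z \in s -> ~~ (if b then (k < y) && (z < k) else (y < k) && (k < z)).
  by move=> zs; rewrite -split_freeE ?sky //; apply: contraNneq ks => ->.
(* In the two middle cases [y] belongs to the block that comes second, so avoidance puts all of [s]
   in that block and the other filter is empty. *)
case: b free eqs => free eqs; case: (ltngtP y k) ky => // lty _ /=; first by rewrite -eqs.
- have -> : [seq x <- s | x < k] = [::].
    by apply/eqP; rewrite -[_ == _]negbK -has_filter; apply/hasPn => z /free; rewrite lty.
  rewrite /=; congr (_ :: _); apply/esym/all_filterP/allP => z zs.
  have : k != z by apply: contraNneq ks => ->.
  by have := free z zs; rewrite lty; case: ltngtP.
- have -> : [seq x <- s | k < x] = [::].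
    by apply/eqP; rewrite -[_ == _]negbK -has_filter; apply/hasPn => z /free; rewrite lty.
  rewrite /=; congr (_ :: _); apply/esym/all_filterP/allP => z zs.
  have : k != z by apply: contraNneq ks => ->.
  by have := free z zs; rewrite lty; case: ltngtP.
- by rewrite -eqs.
Qed.

(** The offset [m] lets both blocks keep their own letters, with no standardisation. *)
Definition avoiders m n := [seq w <- permutations (iota m n) | triplewise split_free w].

Lemma mem_avoiders m n w :
  (w \in avoiders m n) = perm_eq w (iota m n) && triplewise split_free w.
Proof. by rewrite mem_filter mem_permutations andbC. Qed.

Lemma avoiders_uniq m n : uniq (avoiders m n).
Proof. by rewrite filter_uniq ?permutations_uniq. Qed.

Lemma avoiders_bounds m n w x : w \in avoiders m n -> x \in w -> m <= x < m + n.
Proof. by rewrite mem_avoiders => /andP[/perm_mem-> _]; rewrite mem_iota. Qed.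

Lemma avoiders_size m n w : w \in avoiders m n -> size w = n.
Proof. by rewrite mem_avoiders => /andP[/perm_size-> _]; rewrite size_iota. Qed.

Lemma perm_glue A B : perm_eq (glue A B) (A ++ B).
Proof. by rewrite /glue; case: b; rewrite // perm_catC. Qed.

(** The first letter recovers both blocks, which makes the decomposition injective. *)
Lemma filter_glue m k n A B : A \in avoiders m k -> B \in avoiders (m + k).+1 n ->
  ([seq x <- glue A B | x < m + k] = A) * ([seq x <- glue A B | m + k < x] = B).
Proof.
move=> hA hB; have hA1 x := @avoiders_bounds _ _ _ x hA; have hB1 x := @avoiders_bounds _ _ _ x hB.
have A0 : [seq x <- A | m + k < x] = [::].
  by rewrite (@eq_in_filter _ _ pred0) ?filter_pred0 // => x /hA1 /=; lia.
have A1 : [seq x <- A | x < m + k] = A.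
  by rewrite (@eq_in_filter _ _ predT) ?filter_predT // => x /hA1 /=; lia.
have B0 : [seq x <- B | x < m + k] = [::].
  by rewrite (@eq_in_filter _ _ pred0) ?filter_pred0 // => x /hB1 /=; lia.
have B1 : [seq x <- B | m + k < x] = B.
  by rewrite (@eq_in_filter _ _ predT) ?filter_predT // => x /hB1 /=; lia.
by rewrite /glue; case: b; rewrite !filter_cat A0 A1 B0 B1 ?cats0.
Qed.

Lemma cons_glue_avoiders m n k A B : k <= n ->
  A \in avoiders m k -> B \in avoiders (m + k).+1 (n - k) ->
  m + k :: glue A B \in avoiders m n.+1.
Proof.
move=> lekn hA hB; have hA1 x := @avoiders_bounds _ _ _ x hA.
have hB1 x := @avoiders_bounds _ _ _ x hB.
move: hA hB; rewrite !mem_avoiders => /andP[pA tA] /andP[pB tB]; apply/andP; split.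
  have -> : n.+1 = (k + (n - k).+1) by lia.
  rewrite iotaD /= perm_sym perm_catC /= perm_cons perm_sym.
  by rewrite (permPl (perm_glue _ _)) perm_catC perm_cat.
(* 231 ends below its start while [A ++ B] rises from block to block; 213 ends above its start while
   [B ++ A] falls. *)
have freeAB x y z : x \in A -> z \in B -> (if b then split_free x y z else split_free z y x).
  move=> /hA1 ? /hB1 ?; rewrite /split_free /pat_free; case: b => /=.
    by rewrite (_ : (x < z) = true) ?andbF //; lia.
  by rewrite (_ : (z < x) = false) ?andbF //; lia.
have ne x : x \in glue A B -> m + k != x.
  by rewrite (perm_mem (perm_glue _ _)) mem_cat => /orP[/hA1|/hB1]; lia.
apply/andP; split.
  have free y z : y \in glue A B -> z \in glue A B ->
    ~~ (if b then (m + k < y) && (z < m + k) else (y < m + k) && (m + k < z)) ->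
    split_free (m + k) y z by move=> hy hz; rewrite split_freeE ?ne.
  move: free; rewrite /glue; case: b => free; rewrite pairwise_cat; apply/and3P; split.
  - by apply/allrelP => y z hy hz; rewrite free ?mem_cat ?hy ?hz ?orbT //;
      have := hA1 _ hy; lia.
  - by apply: pairwise_in => y z hy hz; rewrite free ?mem_cat ?hy ?hz ?orbT //;
      have := hA1 _ hy; lia.
  - by apply: pairwise_in => y z hy hz; rewrite free ?mem_cat ?hy ?hz ?orbT //;
      have := hB1 _ hz; lia.
  - by apply/allrelP => y z hy hz; rewrite free ?mem_cat ?hy ?hz ?orbT //;
      have := hB1 _ hy; lia.
  - by apply: pairwise_in => y z hy hz; rewrite free ?mem_cat ?hy ?hz ?orbT //;
      have := hB1 _ hy; lia.
  - by apply: pairwise_in => y z hy hz; rewrite free ?mem_cat ?hy ?hz ?orbT //;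
      have := hA1 _ hz; lia.
by rewrite /glue; case: b freeAB => freeAB; apply: triplewise_cat => // x z hx hz y;
  apply: freeAB.
Qed.

Lemma avoiders_consP m n w : w \in avoiders m n.+1 -> exists k A B,
  [/\ k <= n, A \in avoiders m k, B \in avoiders (m + k).+1 (n - k) & w = m + k :: glue A B].
Proof.
case: w => [|x s]; first by move/avoiders_size.
rewrite mem_avoiders => /andP[pw /= /andP[px ts]].
have /andP[xs us] : uniq (x :: s) by rewrite (perm_uniq pw) iota_uniq.
have mem y : (y \in x :: s) = (m <= y < m + n.+1) by rewrite (perm_mem pw) mem_iota.
have xb : m <= x < m + n.+1 by rewrite -mem inE eqxx.
have eqs := split_free_glue xs px.
have [tA tB] : triplewise split_free [seq y <- s | y < x] /\
          triplewise split_free [seq y <- s | x < y].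
  move: ts; rewrite {1}eqs /glue; case: b => /[dup] /triplewise_catl ? /triplewise_catr.
    by split.
  by split.
have mems y : (y \in s) = (y != x) && (m <= y < m + n.+1).
  by rewrite -mem inE; case: eqVneq => [->|]; rewrite ?(negPf xs).
exists (x - m), [seq y <- s | y < x], [seq y <- s | x < y].
rewrite !mem_avoiders subnKC; last by lia.
rewrite tA tB !andbT; split=> //; first by lia.
- apply: uniq_perm; rewrite ?filter_uniq ?iota_uniq // => y.
  by rewrite mem_filter mems mem_iota; lia.
- apply: uniq_perm; rewrite ?filter_uniq ?iota_uniq // => y.
  by rewrite mem_filter mems mem_iota; lia.
- by congr (_ :: _).
Qed.

Lemma perm_avoiders_cons m n :
  perm_eq (avoiders m n.+1)
    [seq m + k :: glue p.1 p.2 | k <- iota 0 n.+1,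
       p <- [seq (A, B) | A <- avoiders m k, B <- avoiders (m + k).+1 (n - k)]].
Proof.
apply: uniq_perm; first exact: avoiders_uniq.
  apply: allpairs_uniq_dep => [|k _|].
  - exact: iota_uniq.
  - by apply: allpairs_uniq; rewrite ?avoiders_uniq // => -[A B] [A' B'].
  move=> p p1 /allpairsPdep[k [u [_ /allpairsP[[A B] [hA hB ->]] ->]]].
  move=> /allpairsPdep[k' [u1 [_ /allpairsP[[A' B'] [hA' hB' ->]] ->]]] /= [].
  move=> /addnI eqk; rewrite /= in hA hB hA' hB'; move: hA' hB'; rewrite -eqk => hA' hB' eqg.
  have EA : A = A' by rewrite -(filter_glue hA hB) eqg (filter_glue hA' hB').
  have EB : B = B' by rewrite -(filter_glue hA hB).2 eqg (filter_glue hA' hB').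
  by rewrite EA EB.
move=> w; apply/idP/allpairsPdep => [/avoiders_consP[k [A [B [lekn hA hB ->]]]]|].
  exists k, (A, B); rewrite mem_iota ltnS lekn; split=> //.
  by apply/allpairsP; exists (A, B).
move=> [k [u [+ /allpairsP[[A B] [/= hA hB ->]] ->]]]; rewrite mem_iota ltnS => lekn.
exact: cons_glue_avoiders.
Qed.

Lemma big_avoiders_cons (R : nmodType) m n (f : seq nat -> R) :
  (\sum_(w <- avoiders m n.+1) f w =
   \sum_(k < n.+1) \sum_(A <- avoiders m k) \sum_(B <- avoiders (m + k).+1 (n - k))
      f (m + k :: glue A B)%N)%R.
Proof.
rewrite (perm_big _ (perm_avoiders_cons m n)) big_allpairs_dep /=.
rewrite -[RHS](big_mkord xpredT (fun k => \sum_(A <- avoiders m k)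
  \sum_(B <- avoiders (m + k).+1 (n - k)) f (m + k :: glue A B)%N)%R) /index_iota subn0.
by apply: eq_bigr => k _; rewrite big_allpairs.
Qed.

End FirstLetter.

(** * Weights of adjacent pairs and their sums over avoiders *)

Section PairWeights.
Local Open Scope ring_scope.

Section PairWeight.
Variables (R : comUnitRingType) (al be ga de : R).

(** [al] and [ga] mark descents and ascents; [be] and [de] mark the 31-2 and 13-2 occurrences
    starting there. The four parameters serve both statistics at once. *)
Definition step x y v : R :=
  if (y < x)%N then al * be ^+ count (fun c => (y < c < x)%N) v
  else ga * de ^+ count (fun c => (x < c < y)%N) v.

Fixpoint pair_weight (w : seq nat) : R :=
  if w is x :: u then if u is y :: v then step x y v * pair_weight u else 1 else 1.

Definition beyond (d : bool) (E : seq nat) (x : nat) :=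
  all (fun z => if d then z < x else x < z)%N E.

Lemma pair_weight_head d E x k : beyond d E x -> beyond d E k -> pair_weight (x :: E) = pair_weight (k :: E).
Proof.
case: E => //= y v /andP[yx vx] /andP[yk vk]; congr (_ * _); rewrite /step.
have -> : (y < x = (y < k))%N by case: d yx yk {vx vk} => yx yk; lia.
case: ltnP => ltyk; congr (_ * _ ^+ _); apply: eq_in_count => c cv;
  have := allP vx _ cv; have := allP vk _ cv; case: d {vx vk} yx yk; lia.
Qed.

(** No letter of [E] lies between two letters of [x :: C], so [E] adds nothing to the counts there;
    and the letter just before [E] matters only through the side of [E] it is on. *)
Lemma pair_weight_cat d C E x k : beyond d E x -> beyond d E k -> all (beyond d E) C ->
  pair_weight (x :: C ++ E) = pair_weight (x :: C) * pair_weight (k :: E).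
Proof.
elim: C x => [|y C IHC] x Ex Ek /=; first by rewrite mul1r => _; apply: pair_weight_head Ek.
case/andP=> Ey EC; have := IHC y Ey Ek EC => /= ->; rewrite mulrA; congr (_ * _ * _).
rewrite /step !count_cat.
have E0 (a : pred nat) : (forall c, a c -> (minn x y < c < maxn x y)%N) -> count a E = 0%N.
  move=> ha; apply/eqP; rewrite -leqn0 leqNgt -has_count; apply/hasPn => c cE.
  apply/negP => /ha; have := allP Ex _ cE; have := allP Ey _ cE.
  by case: d {Ex Ek Ey EC IHC} ; lia.
by case: ltnP => _; rewrite [X in _ ^+ (_ + X)]E0 ?addn0 // => c; lia.
Qed.

Lemma pair_weight_cons2 x y v : pair_weight [:: x, y & v] = step x y v * pair_weight (y :: v).
Proof. by []. Qed.

Local Arguments pair_weight : simpl never.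
Variable b : bool.
Local Notation avoiders := (avoiders b).

(* Depends on [p] only through its position below or above [m, m + n). *)
Definition ext_sum p m n : R := \sum_(w <- avoiders m n) pair_weight (p :: w).

Lemma pair_weight_glue m k n A B : A \in avoiders m k -> B \in avoiders (m + k).+1 n ->
  pair_weight (m + k :: glue b A B)%N = pair_weight (m + k :: A)%N * pair_weight (m + k :: B)%N.
Proof.
move=> hA hB; have hA1 x := @avoiders_bounds _ _ _ _ x hA.
have hB1 x := @avoiders_bounds _ _ _ _ x hB; rewrite /glue; case: b.
  apply: (@pair_weight_cat false); first by apply/allP => x /hB1; lia.
    by apply/allP => x /hB1; lia.
  by apply/allP => y /hA1 ?; apply/allP => x /hB1; lia.
rewrite mulrC; apply: (@pair_weight_cat true); first by apply/allP => x /hA1; lia.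
  by apply/allP => x /hA1; lia.
by apply/allP => y /hB1 ?; apply/allP => x /hA1; lia.
Qed.

Lemma sum_pair_weight m n : \sum_(w <- avoiders m n.+1) pair_weight w =
  \sum_(k < n.+1) ext_sum (m + k) m k * ext_sum (m + k) (m + k).+1 (n - k).
Proof.
rewrite big_avoiders_cons; apply: eq_bigr => k _; rewrite big_distrl /=.
apply: eq_big_seq => A hA; rewrite big_distrr; apply: eq_big_seq => B hB.
exact: pair_weight_glue hB.
Qed.

(** The initial descent from [p] to [m + k] jumps over exactly the [n - k] letters of the upper
    block, in either block order. *)
Lemma ext_sum_down p m n : (m + n < p)%N -> ext_sum p m n.+1 =
  al * \sum_(k < n.+1) be ^+ (n - k) *
       (ext_sum (m + k) m k * ext_sum (m + k) (m + k).+1 (n - k)).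
Proof.
move=> ltp; rewrite /ext_sum big_avoiders_cons big_distrr; apply: eq_bigr => k _ /=.
rewrite big_distrl !big_distrr /=; apply: eq_big_seq => A hA.
rewrite !big_distrr /=; apply: eq_big_seq => B hB.
have lek := ltn_ord k.
have hA1 x := @avoiders_bounds _ _ _ _ x hA; have hB1 x := @avoiders_bounds _ _ _ _ x hB.
rewrite pair_weight_cons2 (pair_weight_glue hA hB) [RHS]mulrA; congr (_ * _); rewrite /step ifT; last by lia.
congr (_ * _ ^+ _); rewrite (seq.permP (perm_glue b A B)) count_cat.
rewrite (@eq_in_count _ _ pred0 A) ?count_pred0; last by move=> x /hA1 /=; lia.
rewrite (@eq_in_count _ _ predT B) ?count_predT; last by move=> x /hB1 /=; lia.
by rewrite (avoiders_size hB).
Qed.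

(** Here the initial ascent jumps over the [k] letters of the lower block. *)
Lemma ext_sum_up p m n : (p < m)%N -> ext_sum p m n.+1 =
  ga * \sum_(k < n.+1) de ^+ k *
       (ext_sum (m + k) m k * ext_sum (m + k) (m + k).+1 (n - k)).
Proof.
move=> ltp; rewrite /ext_sum big_avoiders_cons big_distrr; apply: eq_bigr => k _ /=.
rewrite big_distrl !big_distrr /=; apply: eq_big_seq => A hA.
rewrite !big_distrr /=; apply: eq_big_seq => B hB.
have lek := ltn_ord k.
have hA1 x := @avoiders_bounds _ _ _ _ x hA; have hB1 x := @avoiders_bounds _ _ _ _ x hB.
rewrite pair_weight_cons2 (pair_weight_glue hA hB) [RHS]mulrA; congr (_ * _); rewrite /step ifF; last by lia.
congr (_ * _ ^+ _); rewrite (seq.permP (perm_glue b A B)) count_cat.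
rewrite (@eq_in_count _ _ predT A) ?count_predT; last by move=> x /hA1 /=; lia.
rewrite (@eq_in_count _ _ pred0 B) ?count_pred0; last by move=> x /hB1 /=; lia.
by rewrite (avoiders_size hA) addn0.
Qed.

Lemma ext_sum0 p m : ext_sum p m 0 = 1.
Proof. by rewrite /ext_sum /= big_seq1. Qed.

Definition down_sum n := ext_sum n 0 n.
Definition up_sum n := ext_sum 0 1 n.

(** Both claims are proved together: the right sides of the two recurrences do not mention [p] and
    involve only smaller sums, with [m + k] above one block and below the other. *)
Lemma ext_sum_shift n :
  (forall p m, (m + n <= p)%N -> ext_sum p m n = down_sum n) /\
  (forall p m, (p < m)%N -> ext_sum p m n = up_sum n).
Proof.
elim/ltn_ind: n => -[|n] IH; first by split=> p m _; rewrite ?/down_sum ?/up_sum !ext_sum0.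
have eq_sums f m m' : \sum_(k < n.+1) f k *
    (ext_sum (m + k) m k * ext_sum (m + k) (m + k).+1 (n - k)) =
  \sum_(k < n.+1) (f k : R) *
    (ext_sum (m' + k) m' k * ext_sum (m' + k) (m' + k).+1 (n - k)).
  apply: eq_bigr => k _; have lek := ltn_ord k; congr (_ * (_ * _)).
    by rewrite !(proj1 (IH k lek)).
  by rewrite !(proj2 (IH (n - k)%N _)) // ltnS leq_subr.
split=> p m ltp.
  rewrite /down_sum !ext_sum_down; [|lia..]; congr (_ * _); exact: eq_sums.
by rewrite /up_sum !ext_sum_up //; congr (_ * _); apply: eq_sums.
Qed.

Lemma down_sumS n :
  down_sum n.+1 = al * \sum_(k < n.+1) be ^+ (n - k) * (down_sum k * up_sum (n - k)).
Proof.
rewrite {1}/down_sum ext_sum_down //; congr (_ * _); apply: eq_bigr => k _.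
by rewrite (proj1 (ext_sum_shift _)) ?(proj2 (ext_sum_shift _)).
Qed.

Lemma up_sumS n :
  up_sum n.+1 = ga * \sum_(k < n.+1) de ^+ k * (down_sum k * up_sum (n - k)).
Proof.
rewrite {1}/up_sum ext_sum_up //; congr (_ * _); apply: eq_bigr => k _.
by rewrite (proj1 (ext_sum_shift _)) ?(proj2 (ext_sum_shift _)).
Qed.

Lemma sum_pair_weight_conv m n : \sum_(w <- avoiders m n.+1) pair_weight w = conv down_sum up_sum n.
Proof.
rewrite sum_pair_weight; apply: eq_bigr => k _.
by rewrite (proj1 (ext_sum_shift _)) ?(proj2 (ext_sum_shift _)).
Qed.

End PairWeight.

(** The sequence is [up_sum]: with [de = 1], prepending a smaller letter to a nonempty word only
    multiplies by [t]. *)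
Lemma cek_rec_v31_2 (R : comUnitRingType) (t q : R) b m :
  cek_rec t q (fun n => if n is k.+1 then t * \sum_(w <- avoiders b m n) pair_weight q q t 1 w else 1).
Proof.
have [D0 U0] : down_sum q q t 1 b 0 = 1 /\ up_sum q q t 1 b 0 = 1.
  by split; apply: ext_sum0.
have US n : up_sum q q t 1 b n.+1 = t * conv (down_sum q q t 1 b) (up_sum q q t 1 b) n.
  rewrite up_sumS; congr (_ * _); apply: eq_bigr => k _; by rewrite expr1n mul1r.
have [h0 h1 hS] := cek_rec_left D0 U0 (@down_sumS _ _ _ _ _ _) US.
split=> // [|n]; first by rewrite sum_pair_weight_conv -US.
rewrite !sum_pair_weight_conv -!US hS; congr (_ + _); apply: eq_bigr => k _.
have lek := ltn_ord k; rewrite (_ : n.+1 - k = (n - k).+1)%N; last by lia.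
by rewrite sum_pair_weight_conv -US; case: (k : nat) => [|j]; rewrite ?h0 // sum_pair_weight_conv -US.
Qed.

Lemma cek_rec_v13_2 (R : comUnitRingType) (t q : R) b m :
  cek_rec t q (fun n => if n is k.+1 then t * \sum_(w <- avoiders b m n) pair_weight q 1 t q w else 1).
Proof.
have [D0 U0] : down_sum q 1 t q b 0 = 1 /\ up_sum q 1 t q b 0 = 1.
  by split; apply: ext_sum0.
have DS n : down_sum q 1 t q b n.+1 = q * conv (down_sum q 1 t q b) (up_sum q 1 t q b) n.
  rewrite down_sumS; congr (_ * _); apply: eq_bigr => k _; by rewrite expr1n mul1r.
have [_ h1 hS] := cek_rec_right D0 U0 DS (@up_sumS _ _ _ _ _ _).
split=> // [|n]; first by rewrite sum_pair_weight_conv.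
rewrite !sum_pair_weight_conv hS; congr (_ + _); apply: eq_bigr => k _.
have lek := ltn_ord k; rewrite (_ : n.+1 - k = (n - k).+1)%N; last by lia.
by rewrite sum_pair_weight_conv; case: (k : nat) => [|j]; rewrite // sum_pair_weight_conv.
Qed.

End PairWeights.

(** * Appending a last letter *)

Section LastLetter.
Implicit Types (w u s : seq nat) (n v x : nat).

Lemma ltn_bump v x y : (bump v x < bump v y) = (x < y).
Proof. by rewrite /bump; lia. Qed.

Definition append_letter v w := rcons (map (bump v) w) v.

Lemma append_letter_perm n v w : perm_eq w (iota 1 n) -> v \in iota 1 n.+1 ->
  perm_eq (append_letter v w) (iota 1 n.+1).
Proof.
move=> pw; rewrite mem_iota => hv.
have hw x : (x \in w) = (0 < x < 1 + n) by rewrite (perm_mem pw) mem_iota.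
have U : uniq (append_letter v w).
  rewrite rcons_uniq map_inj_uniq ?(perm_uniq pw) ?iota_uniq; last first.
    exact: can_inj (bumpK v).
  by rewrite andbT; apply/mapP => -[x _]; rewrite /bump; lia.
have sub : {subset append_letter v w <= iota 1 n.+1}.
  move=> x; rewrite mem_rcons inE mem_iota => /orP[/eqP->|/mapP[y]]; first by lia.
  by rewrite hw /bump => ? ->; lia.
apply: uniq_perm; rewrite ?iota_uniq //; have [] // := uniq_min_size U sub.
by rewrite size_rcons size_map (perm_size pw) !size_iota.
Qed.

(** Injectivity and inclusion suffice, because the sizes agree: [n.+1] choices of [v] for each of n!
    words. *)
Lemma permutations_append n : perm_eq (permutations (iota 1 n.+1))
  [seq append_letter v w | w <- permutations (iota 1 n), v <- iota 1 n.+1].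
Proof.
set L := [seq _ | _ <- _, _ <- _].
have U : uniq L.
  apply: allpairs_uniq; rewrite ?permutations_uniq ?iota_uniq //.
  move=> [w v] [w1 v1] _ _ /= /rcons_inj[+ eqv]; rewrite -eqv => /inj_map-> //.
  exact: can_inj (bumpK v).
have sub : {subset L <= permutations (iota 1 n.+1)}.
  move=> x /allpairsP[[w v] /= []]; rewrite !mem_permutations => pw hv ->.
  exact: append_letter_perm.
rewrite perm_sym; apply: uniq_perm; rewrite ?permutations_uniq //.
have [] // := uniq_min_size U sub.
rewrite size_allpairs !size_permutations ?iota_uniq // !size_iota.
by rewrite factS mulnC.
Qed.

Fixpoint invw w := if w is x :: u then count (fun y => y < x) u + invw u else 0.

Lemma invw_rcons w v : invw (rcons w v) = invw w + count (fun x => v < x) w.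
Proof. by elim: w => //= x w ->; rewrite -cats1 count_cat /=; lia. Qed.

Lemma invw_bump v w : invw (map (bump v) w) = invw w.
Proof.
elim: w => //= x w ->; rewrite count_map; congr (_ + _).
by apply: eq_count => y /=; rewrite ltn_bump.
Qed.

(** Positions count from 0 and letters from 1, so the strict inequality expresses a weak
    excedance. *)
Definition wexw w := \sum_(i < size w) (i < nth 0 w i).

(* The largest letter that has a larger one before it, [0] if there is none. *)
Fixpoint max_bottom w :=
  if w is x :: u then maxn (\max_(y <- u | y < x) y) (max_bottom u) else 0.

Lemma max_bottom_lt v w : 0 < v ->
  (max_bottom w < v) = pairwise (fun x y => (y < x) ==> (y < v)) w.
Proof.
move=> v0; elim: w => //= x w <-; rewrite gtn_max; congr (_ && _).
elim: w => [|y w IHw] /=; first by rewrite big_nil.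
by rewrite big_cons -IHw; case: (y < x); rewrite ?gtn_max.
Qed.

Lemma max_bottom_rcons w v :
  max_bottom (rcons w v) = maxn (max_bottom w) (if has (fun x => v < x) w then v else 0).
Proof.
elim: w => [|x w IHw] /=; first by rewrite big_nil.
rewrite IHw -cats1 big_cat big_cons big_nil.
by case: ltnP => _ /=; case: has; lia.
Qed.

Lemma max_bottom_bump v w : 0 < v -> max_bottom w < v -> max_bottom (map (bump v) w) = max_bottom w.
Proof.
move=> v0; elim: w => //= x w IHw; rewrite gtn_max => /andP[xv /IHw->].
congr maxn; rewrite big_map; elim: w {IHw} xv => [|y w IHw]; first by rewrite !big_nil.
rewrite !big_cons ltn_bump; case: (y < x) => //; rewrite gtn_max => /andP[yv /IHw->].
by rewrite /bump leqNgt yv.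
Qed.

(** A 321 ending in the new letter is an inversion of [w] whose bottom ends above [v] after the
    bump, that is, was at least [v] before. *)
Lemma free321_append v w : uniq w -> 0 < v ->
  triplewise (pat_free 3 2 1) (append_letter v w) = triplewise (pat_free 3 2 1) w && (max_bottom w < v).
Proof.
move=> Uw v0; rewrite triplewise_rcons max_bottom_lt // pairwise_map; congr (_ && _).
  elim: w {Uw} => //= x w ->; congr (_ && _); rewrite pairwise_map.
  by apply: eq_pairwise => y z; rewrite /= /pat_free !ltn_bump.
elim: w Uw => //= x w IHw /andP[xw /IHw->]; congr (_ && _).
apply: eq_in_all => y yw; have : y != x by apply: contraNneq xw => <-.
by rewrite /pat_free /bump /=; lia.
Qed.

Section App.
Variables (n v : nat) (w : seq nat).
Hypotheses (pw : perm_eq w (iota 1 n)) (v_bounds : max_bottom w < v <= n.+1).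

Let v0 : 0 < v. Proof. by case/andP: v_bounds; case: v. Qed.

Lemma invw_append : invw (append_letter v w) = invw w + (n.+1 - v).
Proof.
rewrite invw_rcons invw_bump count_map (seq.permP pw); congr (_ + _).
have v_le : v <= n.+1 by case/andP: v_bounds.
rewrite (@eq_count _ _ (fun x => v <= x)); last by move=> x /=; rewrite /bump; lia.
have -> : n = v.-1 + (n.+1 - v) by lia.
rewrite iotaD count_cat add1n prednK //.
rewrite (@eq_in_count _ _ pred0) ?count_pred0; last by move=> x; rewrite mem_iota /=; lia.
rewrite (@eq_in_count _ _ predT) ?count_predT ?size_iota; first by lia.
by move=> x; rewrite mem_iota /=; lia.
Qed.

Lemma max_bottom_append : max_bottom (append_letter v w) = if v == n.+1 then max_bottom w else v.
Proof.
have /andP[bot_v v_le] := v_bounds; rewrite max_bottom_rcons max_bottom_bump // has_map.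
case: eqVneq => vn.
  rewrite ifF ?maxn0 //; apply/negbTE/hasPn => x; rewrite (perm_mem pw) mem_iota /= /bump.
  by lia.
rewrite ifT; first by lia.
(* The letter [n] of [w] is bumped to [n.+1], which exceeds [v]. *)
by apply/hasP; exists n; rewrite ?(perm_mem pw) ?mem_iota /= /bump; lia.
Qed.

(* The letters shifted by [bump v] are left-to-right maxima, hence already weak
   excedances. *)
Lemma wexw_append : wexw (append_letter v w) = wexw w + (v == n.+1).
Proof.
have size_w : size w = n by rewrite (perm_size pw) size_iota.
have /andP[bot_v v_le] := v_bounds.
rewrite /wexw size_rcons size_map big_ord_recr /= nth_rcons size_map ltnn eqxx; congr (_ + _).
  apply: eq_bigr => i _; rewrite nth_rcons size_map ltn_ord (nth_map 0) //.
  congr nat_of_bool; have [v_wi|] := leqP v (nth 0 w i); last by rewrite /bump; lia.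
  suff : i < nth 0 w i by rewrite /bump; lia.
  have w_i : 0 < nth 0 w i by apply: leq_trans v_wi.
  (* The [i] letters before this one are distinct, positive and smaller than it. *)
  have : size (take i w) <= size (iota 1 (nth 0 w i).-1).
    apply: uniq_leq_size; first by rewrite take_uniq // (perm_uniq pw) iota_uniq.
    move=> x /(nthP 0)[j]; rewrite size_takel ?(ltnW (ltn_ord i)) // => ltji.
    rewrite nth_take // => <-; rewrite mem_iota add1n prednK //.
    have lt_j : j < size w by apply: ltn_trans (ltn_ord i).
    have : nth 0 w j \in w by apply: mem_nth.
    rewrite (perm_mem pw) mem_iota => /andP[-> _] /=.
    move: bot_v; rewrite max_bottom_lt // => /(pairwiseP 0)/(_ j i lt_j (ltn_ord i) ltji).
    rewrite [nth 0 w i < v]ltnNge v_wi implybF -leqNgt leq_eqVlt => /orP[/eqP eqji|//].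
    have := nth_uniq 0 lt_j (ltn_ord i); rewrite (perm_uniq pw) iota_uniq => /(_ isT).
    by rewrite eqji eqxx; lia.
  by rewrite size_takel ?(ltnW (ltn_ord i)) // size_iota; lia.
by rewrite size_w; lia.
Qed.

Lemma max_bottom_le : max_bottom w <= n.
Proof.
rewrite -ltnS max_bottom_lt //; apply: pairwise_in => x y _.
by rewrite (perm_mem pw) mem_iota add1n => /andP[_ ->]; rewrite implybT.
Qed.

End App.

Local Open Scope ring_scope.

(** The weight [g] of the final label is arbitrary so that the induction can absorb the last letter
    by replacing [g] with [grow g]. *)
Lemma sum_free321 (R : comUnitRingType) (t q : R) n g :
  \sum_(w <- permutations (iota 1 n) | triplewise (pat_free 3 2 1) w)
      t ^+ wexw w * q ^+ invw w * g (n - max_bottom w)%N =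
  iter n (grow t q) g 0%N.
Proof.
elim: n g => [|n IHn] g.
  by rewrite /= big_cons big_nil /= /wexw big_ord0 !mul1r addr0.
rewrite iterSr -IHn (perm_big _ (permutations_append n)) big_mkcond big_allpairs_dep /=.
rewrite [RHS]big_mkcond; apply: eq_big_seq => w; rewrite mem_permutations => pw.
have Uw : uniq w by rewrite (perm_uniq pw) iota_uniq.
have botn := max_bottom_le pw.
transitivity (\sum_(1 <= v < n.+2 | triplewise (pat_free 3 2 1) w && (max_bottom w < v)%N)
   t ^+ wexw (append_letter v w) * q ^+ invw (append_letter v w) * g (n.+1 - max_bottom (append_letter v w))%N).
  rewrite -big_mkcond /index_iota subn1 big_seq_cond [RHS]big_seq_cond.
  by apply: eq_bigl => v; rewrite mem_iota; case: ltnP => //= v0; rewrite free321_append.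
case: (triplewise _ w); last by rewrite big_pred0_eq.
rewrite /= (@big_cat_nat _ _ _ (max_bottom w).+1) //=; last by lia.
rewrite big_nat_cond big_pred0 ?add0r => [|v]; last by lia.
have terms v : (max_bottom w < v <= n.+1)%N ->
    t ^+ wexw (append_letter v w) * q ^+ invw (append_letter v w) * g (n.+1 - max_bottom (append_letter v w))%N =
    t ^+ wexw w * q ^+ invw w *
      (t ^+ (v == n.+1) * q ^+ (n.+1 - v) * g (n.+1 - if v == n.+1 then max_bottom w else v)%N).
  move=> hv; rewrite (wexw_append pw hv) (invw_append pw hv) (max_bottom_append pw hv) !exprD; ring.
set F := fun v => t ^+ (v == n.+1) * q ^+ (n.+1 - v) *
  g (n.+1 - if v == n.+1 then max_bottom w else v)%N in terms *.
transitivity (\sum_((max_bottom w).+1 <= v < n.+2) t ^+ wexw w * q ^+ invw w * F v).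
  rewrite big_nat_cond [RHS]big_nat; apply: eq_big => [v|v /andP[hv _]]; first by lia.
  by rewrite terms //; lia.
rewrite -big_distrr /=; congr (_ * _); rewrite big_nat_recr //= addrC; congr (_ + _).
  by rewrite /F eqxx subnn expr1 expr0 mulr1 subSn.
(* Reindexing by [j = n.+1 - v], both the number of new inversions and the new label. *)
rewrite big_nat_rev -{1}[(max_bottom w).+1]add1n big_addn /= subSn //.
rewrite big_nat [RHS]big_nat; apply: eq_bigr => j hj; rewrite /F.
have -> : ((max_bottom w).+1 + n.+1 - (j + max_bottom w).+1 = n.+1 - j)%N by lia.
have -> : (n.+1 - j == n.+1)%N = false by lia.
by rewrite mul1r subKn //; lia.
Qed.

End LastLetter.

(** * Statistics of words and permutations *)

Section WordStats.
Implicit Types (w u : seq nat).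

(** The third argument of [f] is the suffix after the adjacent pair, where the 2 of 31-2 or 13-2 is
    sought. *)
Fixpoint adj_sum (f : nat -> nat -> seq nat -> nat) w : nat :=
  if w is x :: u then (if u is y :: v then f x y v else 0) + adj_sum f u else 0.

Lemma sum_count (a : pred nat) w : \sum_(0 <= j < size w) a (nth 0 w j) = count a w.
Proof.
rewrite -sum1_count [RHS](big_nth 0) [RHS]big_mkcond; apply: eq_bigr => i _.
by case: (a _).
Qed.

Lemma invw_sum w : \sum_(0 <= i < size w) \sum_(0 <= j < size w)
  ((i < j) && (nth 0 w j < nth 0 w i)) = invw w.
Proof.
elim: w => [|x w IHw] /=; first by rewrite big_nil.
rewrite big_nat_recl // big_nat_recl //= add0n; congr (_ + _).
  by rewrite -sum_count; apply: eq_bigr.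
by rewrite -IHw; apply: eq_bigr => i _; rewrite big_nat_recl.
Qed.

Lemma adj_sum1 (a : rel nat) w :
  \sum_(0 <= i < (size w).-1) a (nth 0 w i) (nth 0 w i.+1) = adj_sum (fun x y _ => a x y) w.
Proof.
elim: w => [|x [|y w] IHw]; [by rewrite big_geq.. |].
by rewrite -[RHS]/(a x y + adj_sum _ (y :: w)) -IHw /= big_nat_recl.
Qed.

Lemma adj_sum2 (a : nat -> nat -> pred nat) w :
  \sum_(0 <= i < size w) \sum_(0 <= j < size w)
     ((i.+1 < j) && a (nth 0 w i) (nth 0 w i.+1) (nth 0 w j)) =
  adj_sum (fun x y v => count (a x y) v) w.
Proof.
elim: w => [|x w IHw]; first by rewrite big_nil.
rewrite /= big_nat_recl //; congr (_ + _).
  case: w {IHw} => [|y w] /=; first by rewrite big_nat1.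
  by rewrite !big_nat_recl //= !add0n -sum_count; apply: eq_bigr.
by rewrite -IHw; apply: eq_bigr => i _; rewrite big_nat_recl.
Qed.

Definition desw := adj_sum (fun x y _ => y < x).
Definition ascw := adj_sum (fun x y _ => ~~ (y < x)).
Definition v31w := adj_sum (fun x y v => count (fun c => y < c < x) v).
Definition v13w := adj_sum (fun x y v => count (fun c => x < c < y) v).

Lemma desw_ascw w : desw w + ascw w = (size w).-1.
Proof.
elim: w => [|x [|y w] IHw] //; move: IHw.
by rewrite /desw /ascw /= => <-; case: ltnP => _; lia.
Qed.

(** Descents contribute nothing to [v13w] and ascents nothing to [v31w], so the case split in [step]
    becomes a plain product. *)
Lemma pair_weightE (R : comUnitRingType) (al be ga de : R) w :
  (pair_weight al be ga de w =
   al ^+ desw w * be ^+ v31w w * (ga ^+ ascw w * de ^+ v13w w))%R.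
Proof.
elim: w => [|x [|y w] IHw]; rewrite ?expr0 ?mulr1 //.
rewrite pair_weight_cons2 IHw /step.
rewrite -[desw [:: x, _ & _]]/((y < x) + desw (y :: w)).
rewrite -[ascw [:: x, _ & _]]/(~~ (y < x) + ascw (y :: w)).
rewrite -[v31w [:: x, _ & _]]/(count (fun c => y < c < x) w + v31w (y :: w)).
rewrite -[v13w [:: x, _ & _]]/(count (fun c => x < c < y) w + v13w (y :: w)) !exprD.
case: ltnP => xy.
  rewrite (@eq_count _ (fun c => x < c < y) pred0) ?count_pred0; last by move=> c /=; lia.
  by rewrite !expr0 expr1; ring.
rewrite (@eq_count _ (fun c => y < c < x) pred0) ?count_pred0; last by move=> c /=; lia.
by rewrite !expr0 expr1; ring.
Qed.

End WordStats.

(** * Statistics of permutations and the reverse-complement *)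

Section PermStats.
Variable n : nat.
Implicit Types s : {perm 'I_n}.

Lemma wexE s : wex s = wexw (word s).
Proof. by rewrite /wex /wexw big_add1 size_word big_mkord. Qed.

Lemma invnE s : invn s = invw (word s).
Proof.
rewrite -invw_sum size_word /invn big_add1; apply: eq_bigr => i _.
by rewrite big_add1.
Qed.

Lemma desE s : des s = desw (word s).
Proof.
by rewrite /desw -(adj_sum1 (fun x y => y < x)) size_word /des big_add1.
Qed.

Lemma v31_2E s : v31_2 s = v31w (word s).
Proof.
rewrite /v31w -(adj_sum2 (fun x y c => y < c < x)) size_word /v31_2 big_add1.
by apply: eq_bigr => i _; rewrite big_add1; apply: eq_bigr => j _; rewrite -andbA.
Qed.

Lemma v13_2E s : v13_2 s = v13w (word s).
Proof.
rewrite /v13w -(adj_sum2 (fun x y c => x < c < y)) size_word /v13_2 big_add1.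
by apply: eq_bigr => i _; rewrite big_add1; apply: eq_bigr => j _; rewrite -andbA.
Qed.

Lemma P_le s i : P s i <= n.+1.
Proof.
case: i => [|i] //; rewrite /P /=; case: (ltnP i n) => lt_i.
  by rewrite (nth_word s (Ordinal lt_i)) ltnS ltnW.
by rewrite nth_default ?size_word.
Qed.

Lemma P_inj s i j : 0 < i <= n -> 0 < j <= n -> P s i = P s j -> i = j.
Proof.
case: i j => [|i] [|j] //= lt_i lt_j /eqP; rewrite /P /=.
by rewrite nth_uniq ?size_word ?(perm_uniq (word_perm s)) ?iota_uniq // => /eqP->.
Qed.

Lemma avoids231P s i j k : avoids3 2 3 1 s -> 0 < i -> i < j -> j < k -> k <= n ->
  ~~ ((P s i < P s j) && (P s k < P s i)).
Proof.
rewrite avoids3E => /triplewiseP av; case: i j k => [|i] [|j] [|k] // _ ltij ltjk.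
move=> ltk; have := av i j k ltij ltjk; rewrite size_word => /(_ ltk).
by rewrite /P /pat_free /=; lia.
Qed.

(* A star admissible inversion through an intermediate [l] is a 231. *)
Lemma adis_v13_2 s : avoids3 2 3 1 s -> adis s = v13_2 s.
Proof.
move=> av; case: (posnP n) => [n0|n_gt0].
  by rewrite /adis /v13_2 !big_geq ?n0.
(* The inversion at [i.+1] is matched with the 13-2 starting at [i]. Left over are position 1,
   preceded by the sentinel [n.+1], and the 13-2 terms at [i = n], which have no room for [j]. *)
rewrite /adis /v13_2 big_ltn // [X in _ + X = _]big_add1 /= [RHS]big_nat_recr //=.
have noex i j : 0 < i -> j <= n ->
    [exists l : 'I_n.+1, [&& i < l, l < j & P s i < P s l]] && (P s j < P s i) = false.
  move=> i0 jn; apply/negP => /andP[/existsP[l /and3P[il lj Pil]] Pji].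
  by have := avoids231P av i0 il lj jn; rewrite Pil Pji.
rewrite [X in X + _]big_nat_cond big1 => [|j /andP[/andP[_ jn] _]]; last first.
  have := P_le s 1; have := noex 1 j isT jn; rewrite /P /= -/(P s 1).
  by case: [exists _, _] => /=; lia.
rewrite [X in _ = _ + X]big_nat_cond [X in _ = _ + X]big1 => [|j /andP[hj _]]; last by lia.
rewrite add0n addn0; apply: eq_big_nat => i /andP[i0 lt_i].
apply: eq_big_nat => j /andP[j0 jn]; rewrite ltnS in jn; congr nat_of_bool.
have := noex i.+1 j isT jn.
case: [exists _, _] => /= [->|_]; first by rewrite !andbF.
rewrite orbF; case: (ltnP i.+1 j) => //= ltij.
(* If positions [i], [i.+1] form an ascent, avoidance makes [P s i < P s j], the missing half of the
   13-2. *)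
have := avoids231P av i0 (ltnSn i) ltij jn.
have : P s i != P s j by apply/eqP => /P_inj; lia.
by lia.
Qed.

Lemma rc_inj s : injective (fun i => rev_ord (s (rev_ord i))).
Proof. by move=> i j /rev_ord_inj/perm_inj/rev_ord_inj. Qed.

(* The reverse-complement. *)
Definition rc s : {perm 'I_n} := perm (@rc_inj s).

Lemma rcK : involutive rc.
Proof. by move=> s; apply/permP => i; rewrite !permE !rev_ordK. Qed.

(** The two sentinels are exchanged, so the formula includes both ends. *)
Lemma P_rc s i : i <= n.+1 -> P (rc s) i = n.+1 - P s (n.+1 - i).
Proof.
case: i => [_|i]; first by rewrite subn0 /P /= nth_default ?size_word.
rewrite ltnS leq_eqVlt => /orP[/eqP->|lt_i].
  by rewrite subnn /P /= nth_default ?size_word ?subnn.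
rewrite subSS /P /= (nth_word _ (Ordinal lt_i)) permE.
have -> : (n - i == 0) = false by lia.
have -> : (n - i).-1 = rev_ord (Ordinal lt_i) by rewrite /=; lia.
by rewrite nth_word /=; have := ltn_ord (s (rev_ord (Ordinal lt_i))); lia.
Qed.

(** The hypotheses say that a' b' c' is ordered like the reverse-complement of a b c. *)
Lemma avoids3_rc a b c a' b' c' s :
  (a < b) = (b' < c') -> (a < c) = (a' < c') -> (b < c) = (a' < b') ->
  avoids3 a b c (rc s) = avoids3 a' b' c' s.
Proof.
move=> ab ac bc; congr (~~ _).
have E x y : (rc s x < rc s y) = (s (rev_ord y) < s (rev_ord x)).
  rewrite !permE /=; have := ltn_ord (s (rev_ord x)); have := ltn_ord (s (rev_ord y)).
  by lia.
apply/existsP/existsP => -[i /existsP[j /existsP[k /and5P[ij jk h1 h2 h3]]]].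
  exists (rev_ord k); apply/existsP; exists (rev_ord j); apply/existsP; exists (rev_ord i).
  have := ltn_ord k; rewrite -ab -ac -bc -!E h1 h2 h3 /= !andbT; lia.
exists (rev_ord k); apply/existsP; exists (rev_ord j); apply/existsP; exists (rev_ord i).
have := ltn_ord k; rewrite ab ac bc !E !rev_ordK h1 h2 h3 /= !andbT; lia.
Qed.

Lemma des_rc s : des (rc s) = des s.
Proof.
rewrite /des big_nat_rev; apply: eq_big_nat => i hi; rewrite !P_rc; [|lia..].
have -> : n.+1 - (1 + n - i.+1).+1 = i by lia.
have -> : n.+1 - (1 + n - i.+1) = i.+1 by lia.
by have := P_le s i; have := P_le s i.+1; lia.
Qed.

Lemma v2_31_rc s : v2_31 (rc s) = v31_2 s.
Proof.
case: (posnP n) => [n0|n_gt0]; first by rewrite /v2_31 /v31_2 !big_geq ?n0.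
rewrite /v31_2 big_nat_recr //= [X in _ = _ + X]big_nat_cond [X in _ = _ + X]big1 => [|j /andP[hj _]]; last by lia.
rewrite addn0 /v2_31 big_nat_rev; apply: eq_big_nat => i hi.
rewrite big_nat_rev; apply: eq_big_nat => j hj; rewrite !P_rc; [|lia..].
have -> : n.+1 - (1 + n - i.+1).+1 = i by lia.
have -> : n.+1 - (1 + n - i.+1) = i.+1 by lia.
have -> : n.+1 - (1 + n.+1 - j.+1) = j by lia.
by have := P_le s i; have := P_le s i.+1; have := P_le s j; lia.
Qed.

Lemma v2_13_rc s : v2_13 (rc s) = v13_2 s.
Proof.
case: (posnP n) => [n0|n_gt0]; first by rewrite /v2_13 /v13_2 !big_geq ?n0.
rewrite /v13_2 big_nat_recr //= [X in _ = _ + X]big_nat_cond [X in _ = _ + X]big1 => [|j /andP[hj _]]; last by lia.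
rewrite addn0 /v2_13 big_nat_rev; apply: eq_big_nat => i hi.
rewrite big_nat_rev; apply: eq_big_nat => j hj; rewrite !P_rc; [|lia..].
have -> : n.+1 - (1 + n - i.+1).+1 = i by lia.
have -> : n.+1 - (1 + n - i.+1) = i.+1 by lia.
have -> : n.+1 - (1 + n.+1 - j.+1) = j by lia.
by have := P_le s i; have := P_le s i.+1; have := P_le s j; lia.
Qed.

Lemma adi_rc s : adi (rc s) = adis s.
Proof.
(* Reversal swaps the two ends of an inversion, hence the exchange of sums. *)
rewrite /adi exchange_big_nat /= /adis big_nat_rev; apply: eq_big_nat => i hi.
rewrite big_nat_rev; apply: eq_big_nat => j hj; rewrite !P_rc; [|lia..].
have -> : n.+1 - (1 + n.+1 - i.+1).+1 = i.-1 by lia.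
have -> : n.+1 - (1 + n.+1 - i.+1) = i by lia.
have -> : n.+1 - (1 + n.+1 - j.+1) = j by lia.
have Pi := P_le s i; have Pi1 := P_le s i.-1; have Pj := P_le s j.
congr nat_of_bool; congr [&& _, _ & _ || _]; [lia..|].
(* The mirrored position is the witness; [l] is positive, so [n.+1 - l] fits in ['I_n.+1]. *)
apply/existsP/existsP => -[l /and3P[h1 h2 h3]]; have lt_l := ltn_ord l;
  exists (inord (n.+1 - l)); rewrite inordK; try lia; have Pl := P_le s l;
  have Pl' := P_le s (n.+1 - l).
  by rewrite P_rc in h3; lia.
by rewrite P_rc ?subKn; lia.
Qed.

End PermStats.

(** * Comparison of the generating functions *)

Local Open Scope ring_scope.

Section Sums.
Variables (R : comUnitRingType) (t q : R) (n : nat).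

Lemma WnE : Wn n t q = tree_sum t q n 0.
Proof.
rewrite -[RHS](sum_free321 t q n (fun=> 1)) -big_words.
apply: eq_big => [s|s _]; first exact: avoids3E.
by rewrite wexE invnE mulr1.
Qed.

Lemma Wtau_rc a b c a' b' c' (st st' : {perm 'I_n} -> nat) :
  (a < b)%N = (b' < c')%N -> (a < c)%N = (a' < c')%N -> (b < c)%N = (a' < b')%N ->
  (forall s, st (rc s) = st' s) ->
  Wtau a b c st t q = Wtau a' b' c' st' t q.
Proof.
move=> ab ac bc Est; congr (_ * _); rewrite (reindex_inj (inv_inj (@rcK n))) /=.
by apply: eq_big => [s|s _]; [apply: avoids3_rc | rewrite des_rc Est].
Qed.

Lemma eq_Wtau a b c (st st' : {perm 'I_n} -> nat) :
  (forall s, avoids3 a b c s -> st s = st' s) ->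
  Wtau a b c st t q = Wtau a b c st' t q.
Proof. by move=> Est; congr (_ * _); apply: eq_bigr => s /Est->. Qed.

Hypotheses (t_unit : t \is a GRing.unit) (n_gt0 : (0 < n)%N).

(** Descents and ascents total [n.-1], so [t ^+ n] splits into one [t], a [t] per ascent, and a [t]
    per descent that cancels the denominator of [q / t]. *)
Lemma Wtau_pair_weight b (be de : R) (st : {perm 'I_n} -> nat) :
  (forall s, q ^+ st s = be ^+ v31w (word s) * de ^+ v13w (word s)) ->
  Wtau 2 (if b then 3 else 1)%N (if b then 1 else 3)%N st t q =
  t * \sum_(w <- avoiders b 1 n) pair_weight q be t de w.
Proof.
move=> Est; rewrite big_filter -big_words /Wtau !big_distrr /=.
apply: eq_big => [s|s _]; first exact: avoids3E.
rewrite Est pair_weightE desE; have := desw_ascw (word s); rewrite size_word => eqn.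
rewrite -{1}(prednK n_gt0) -eqn exprS exprD exprMn exprVn.
transitivity (t * t ^+ ascw (word s) * q ^+ desw (word s) *
  (be ^+ v31w (word s) * de ^+ v13w (word s)) *
  (t ^+ desw (word s) * (t ^+ desw (word s))^-1)); first by ring.
by rewrite mulrV ?unitrX //; ring.
Qed.

Lemma Wn_v31_2 b :
  Wn n t q = Wtau 2 (if b then 3 else 1)%N (if b then 1 else 3)%N (@v31_2 n) t q.
Proof.
rewrite WnE (@Wtau_pair_weight b q 1) => [|s]; last by rewrite v31_2E expr1n mulr1.
rewrite (cek_rec_unique (cek_rec_tree t q) (cek_rec_v31_2 t q b 1) n).
by case: n n_gt0.
Qed.

Lemma Wn_v13_2 b :
  Wn n t q = Wtau 2 (if b then 3 else 1)%N (if b then 1 else 3)%N (@v13_2 n) t q.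
Proof.
rewrite WnE (@Wtau_pair_weight b 1 q) => [|s]; last by rewrite v13_2E expr1n mul1r.
rewrite (cek_rec_unique (cek_rec_tree t q) (cek_rec_v13_2 t q b 1) n).
by case: n n_gt0.
Qed.

End Sums.

Theorem theorem4p2 (n : nat) (hn : (1 <= n)%N) (R : comUnitRingType) (t q : R)
    (ht : t \is a GRing.unit) :
  Wn n t q = Wtau 2 3 1 (@v31_2 n) t q /\
      Wn n t q = Wtau 2 3 1 (@v13_2 n) t q /\
      Wn n t q = Wtau 2 3 1 (@adis n) t q /\
      Wn n t q = Wtau 3 1 2 (@v2_31 n) t q /\
      Wn n t q = Wtau 3 1 2 (@v2_13 n) t q /\
      Wn n t q = Wtau 3 1 2 (@adi n) t q /\
      Wn n t q = Wtau 2 1 3 (@v31_2 n) t q /\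
      Wn n t q = Wtau 2 1 3 (@v13_2 n) t q /\
      Wn n t q = Wtau 1 3 2 (@v2_31 n) t q /\
      Wn n t q = Wtau 1 3 2 (@v2_13 n) t q.
Proof.
have W31 b := Wn_v31_2 q ht hn b; have W13 b := Wn_v13_2 q ht hn b.
have Wadis : Wn n t q = Wtau 2 3 1 (@adis n) t q.
  by rewrite (W13 true); apply/esym/eq_Wtau; apply: adis_v13_2.
split; first exact: (W31 true).
split; first exact: (W13 true).
split; first exact: Wadis.
split; first by rewrite (Wtau_rc t q (a' := 2) (b' := 3) (c' := 1) _ _ _ (@v2_31_rc n)) // (W31 true).
split; first by rewrite (Wtau_rc t q (a' := 2) (b' := 3) (c' := 1) _ _ _ (@v2_13_rc n)) // (W13 true).
split; first by rewrite (Wtau_rc t q (a' := 2) (b' := 3) (c' := 1) _ _ _ (@adi_rc n)).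
split; first exact: (W31 false).
split; first exact: (W13 false).
split; first by rewrite (Wtau_rc t q (a' := 2) (b' := 1) (c' := 3) _ _ _ (@v2_31_rc n)) // (W31 false).
by rewrite (Wtau_rc t q (a' := 2) (b' := 1) (c' := 3) _ _ _ (@v2_13_rc n)) // (W13 false).
Qed.
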